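(* The flip graph of labeled combinatorial 4-PPTs has diameter $\Omega(n\log n)$: there is a constant $c>0$ such that for all sufficiently large $n$ there exist two labeled combinatorial 4-PPTs on the same $n$ labeled vertices and with the same outer face (same labeled outer vertices in the same cyclic order) such that every sequence of flips transforming one into the other has length at least $c\, n\log n$.
   Context: An angle of a plane embedded graph is an incidence between a vertex and a face. A combinatorial pseudo-triangulation is a combinatorial embedding in the plane (rotation system with a designated outer face) of a connected planar simple graph, with a tag ''reflex'' or ''convex'' on each angle, such that every interior face has exactly three convex angles, all angles of the outer face are reflex, and no vertex is incident to more than one reflex angle. It is pointed if every vertex has exactly one reflex angle. A combinatorial 4-PPT is a combinatorial pointed pseudo-triangulation in which every interior face has size 3 or 4. A labeled combinatorial 4-PPT has distinct labels on its vertices. Flip: let $\triangle$ be an interior triangular face, $e$ an edge of $\triangle$ not on the outer face, $F$ the other face incident to $e$, and $R$ the region obtained by deleting $e$. A flip replaces $e$ by another edge $e'\ne e$ inside $R$ splitting $R$ into a triangular face and a face of the same size as $F$, such that the result (tags outside $R$ unchanged) is again a combinatorial 4-PPT; in particular $e'$ may not join two already adjacent vertices. Flips preserve labels and the outer face. *)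

(* Defs.v *)
From mathcomp Require Import all_boot.
From Stdlib Require Import Rdefinitions Raxioms Rfunctions Rpower.

Set Implicit Arguments.
Unset Strict Implicit.
Unset Printing Implicit Defensive.

(* Vertices are the labels 'I_n themselves (distinct labels).               *)
(* nxt (v,w) = the neighbour following w in the cyclic rotation at v        *)
(*   (the rotation system); for non-neighbours w we require nxt (v,w) = w   *)
(*   so that the data is canonical.                                         *)
(* Face permutation: phi (u,v) = (v, nxt (v,u)); faces are phi-orbits of    *)
(*   darts.  The dart (u,v) represents the angle (corner) at vertex v        *)
(*   between the edges vu and v(nxt(v,u)), which lies in the face of (u,v). *)
(* reflex d = true means the angle d is tagged "reflex", false "convex";    *)
(*   canonically false on non-darts.                                        *)

Record cppt (n : nat) := CPPT {
  adj    : {ffun 'I_n * 'I_n -> bool};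
  nxt    : {ffun 'I_n * 'I_n -> 'I_n};
  reflex : {ffun 'I_n * 'I_n -> bool};
  outer  : {set 'I_n * 'I_n}
}.

Section Defs.
Variable n : nat.
Implicit Types (T : cppt n) (d : 'I_n * 'I_n).

Definition darts T : {set 'I_n * 'I_n} := [set d | adj T d].

Definition phi T (d : 'I_n * 'I_n) : 'I_n * 'I_n := (d.2, nxt T (d.2, d.1)).

Definition face T d : {set 'I_n * 'I_n} :=
  [set d' | adj T d' && fconnect (phi T) d d'].

Definition faces T : {set {set 'I_n * 'I_n}} := [set face T d | d in darts T].

Definition cemb T : Prop :=
  [/\ (forall v, adj T (v, v) = false),
      (forall u v, adj T (u, v) = adj T (v, u)),
   [/\ (forall v w, adj T (v, w) -> adj T (v, nxt T (v, w))),
      (forall v w w', adj T (v, w) -> adj T (v, w') ->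
          nxt T (v, w) = nxt T (v, w') -> w = w') &
      (forall v w w', adj T (v, w) -> adj T (v, w') ->
          fconnect (fun z => nxt T (v, z)) w w')] &
   [/\ (forall v w, adj T (v, w) = false -> nxt T (v, w) = w),
       (forall u v, connect [rel a b | adj T (a, b)] u v),
       (* planarity of the rotation system: Euler's formula V - E + F = 2 *)
       (n + #|faces T|).*2 = #|darts T| + 4,
       outer T \in faces T &
       (forall d, adj T d = false -> reflex T d = false)]].

Definition ppt4 T : Prop :=
  [/\ cemb T,
      (forall f, f \in faces T -> f != outer T ->
          #|[set d in f | ~~ reflex T d]| = 3 /\ (#|f| = 3 \/ #|f| = 4)),
      (forall d, d \in outer T -> reflex T d) &
      (forall v, #|[set d in darts T | (d.2 == v) && reflex T d]| = 1)].

Definition nxt_del T (u v : 'I_n) (z w : 'I_n) : 'I_n :=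
  if (z == u) && (nxt T (u, w) == v) then nxt T (u, v)
  else if (z == v) && (nxt T (v, w) == u) then nxt T (v, u)
  else nxt T (z, w).

(* rotation after deleting {u,v} and then inserting {x,y}, where the new
   edge is placed in the corner (a,x) at x and in the corner (b,y) at y *)
Definition nxt_flip T (u v x y a b : 'I_n) (z w : 'I_n) : 'I_n :=
  if (z == x) && (w == a) then y
  else if (z == x) && (w == y) then nxt_del T u v x a
  else if (z == y) && (w == b) then x
  else if (z == y) && (w == x) then nxt_del T u v y b
  else nxt_del T u v z w.

(* One flip from T to T'.  Triangle Delta = face of dart (u,v) (interior,
   size 3), e = {u,v}, F = face of (v,u) (interior, the other face of e),
   R = Delta u F minus the two darts of e (the merged face after deleting e).
   The new edge e' = {x,y} (x,y not already adjacent) is inserted into R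
   at corners (a,x), (b,y) of R, splitting R into a triangle and a face of
   size |F|; the outer face and all tags outside the two new faces are
   unchanged, and T' is again a combinatorial 4-PPT. *)
Definition flip T T' : Prop :=
  exists u v x y a b : 'I_n,
    let Delta := face T (u, v) in
    let F := face T (v, u) in
    let R := (Delta :|: F) :\: [set (u, v); (v, u)] in
    [/\ ppt4 T, adj T (u, v) &
        [/\ Delta != outer T, F != outer T, Delta != F & #|Delta| = 3]] /\
    [/\ x != y, adj T (x, y) = false, (a, x) \in R & (b, y) \in R] /\
    [/\ (forall d, adj T' d =
           if (d == (u, v)) || (d == (v, u)) then false
           else if (d == (x, y)) || (d == (y, x)) then true
           else adj T d),
        (forall z w, adj T' (z, w) -> nxt T' (z, w) = nxt_flip T u v x y a b z w),
        ((#|face T' (x, y)| = 3 /\ #|face T' (y, x)| = #|F|) \/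
         (#|face T' (y, x)| = 3 /\ #|face T' (x, y)| = #|F|)),
        outer T' = outer T &
        (forall d, adj T' d -> d \notin face T' (x, y) -> d \notin face T' (y, x) ->
           reflex T' d = reflex T d)] /\
    ppt4 T'.

Definition same_outer T T' : Prop :=
  outer T = outer T' /\ (forall d, d \in outer T -> phi T d = phi T' d).

Inductive flip_seq : cppt n -> cppt n -> nat -> Prop :=
  | flip_seq0 T : flip_seq T T 0
  | flip_seqS T T' T'' k : flip T T' -> flip_seq T' T'' k -> flip_seq T T'' k.+1.

End Defs.

(* Main.v *)
Require Import Defs.
From Stdlib Require Import RIneq Exp_prop Rtrigo_def Lra Classical.
From mathcomp Require Import zify.
From mathcomp Require Import all_boot perm.
From Stdlib Require Import Rdefinitions Raxioms Rfunctions Rpower.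

Set Implicit Arguments.
Unset Strict Implicit.
Unset Printing Implicit Defensive.

(** A counting argument in the spirit of Sleator, Tarjan and Thurston.  Give the
darts of a fixed 4-PPT on [n] vertices permanent identities, so that an edge
keeps its two darts when it is flipped.  A flip then rewrites the boundary
pointers and end labels of at most seven darts, and two flips touching disjoint
sets of darts commute, even if performing them in the other order passes
through embeddings with parallel edges.  A sequence of [k] flips can therefore
be replayed from a first-in-first-out queue of darts: read one of boundedly many
symbols, which either discards the dart at the head of the queue or performs a
flip anchored at it, in which case the boundedly many darts whose flips
interact with this one are queued again.  Hence at most [C ^ (n + k)] embeddings
are reachable in [k] flips.  On the other hand, nesting vertices of degree two
below an outer triangle in all possible orders gives [(n - 3)!] distinct 4-PPTs
with the same outer face, so reaching all of them requires [k] to be of order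
[n ln n]. *)

(** * Replaying local rewriting sequences *)

Section LocalRewriting.

Variables (D P : finType) (V : Type).
Let state := {ffun D -> V}.

(* [t s i] lists the cells that an action anchored at [i] reads or writes. *)
Variables (t : state -> D -> seq D) (ex : D * P -> state -> state).
Variables (inv : state -> Prop) (C : nat).

Hypothesis t_anchor : forall s i, i \in t s i.
Hypothesis ex_outside : forall a s c, c \notin t s a.1 -> ex a s c = s c.
Hypothesis t_local : forall (s s' : state) i, {in t s i, s =1 s'} -> t s' i = t s i.
Hypothesis ex_local : forall (s s' : state) a, {in t s a.1, s =1 s'} ->
  {in t s a.1, ex a s =1 ex a s'}.
Hypothesis inv_ex : forall a s, inv s -> inv (ex a s).
Hypothesis t_sparse : forall s s' d, inv s' ->
  #|[set i | has [in t s d] (t s' i)]| <= C.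
Hypothesis C_gt0 : 0 < C.

Fixpoint run (s : state) (w : seq (D * P)) : state :=
  if w is a :: w' then run (ex a s) w' else s.

(* Anchors of the actions of [w] that can be moved to the front of [w] by
   commuting actions with disjoint supports. *)
Fixpoint front (s : state) (w : seq (D * P)) : seq D :=
  if w is a :: w' then
    a.1 :: [seq b <- front (ex a s) w' | ~~ has [in t s a.1] (t (ex a s) b)]
  else [::].

(** The requeued anchors are computed from the states alone, so the symbols [bs] are all the
    information needed for the replay. *)
Fixpoint decode (s : state) (q : seq D) (bs : seq (option P)) : state :=
  match bs, q with
  | None :: bs', _ :: q' => decode s q' bs'
  | Some p :: bs', d :: q' =>
      let s' := ex (d, p) s in
      decode s' (q' ++ enum [set i | has [in t s d] (t s' i)]) bs'
  | _, _ => s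
  end.

(** The action [a] alters no cell of the support that [b] has afterwards, and a support is
    determined by its own cells. *)
Lemma t_ex_disjoint a s b :
  ~~ has [in t s a.1] (t (ex a s) b) -> t s b = t (ex a s) b.
Proof.
move=> /hasPn dis; apply: t_local => c cb.
by rewrite ex_outside //; apply: dis.
Qed.

Lemma t_disjoint_ex a s b :
  ~~ has [in t s a.1] (t s b) -> t (ex a s) b = t s b.
Proof.
move=> /hasPn dis; apply: t_local => c cb.
by rewrite ex_outside //; apply: dis.
Qed.

(** Each cell lies in at most one of the two supports, and by locality either action sees the same
    input in both orders. *)
Lemma ex_comm a b s : ~~ has [in t s a.1] (t (ex a s) b.1) ->
  ex b (ex a s) = ex a (ex b s).
Proof.
move=> dis; have tb := t_ex_disjoint dis.
have dis' c : c \in t s a.1 -> c \notin t s b.1.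
  rewrite tb => ca; apply/negP => cb.
  by move/hasPn: dis => /(_ _ cb); rewrite /= ca.
have ta : t (ex b s) a.1 = t s a.1.
  apply: t_disjoint_ex; apply/hasPn => c; exact: dis'.
apply/ffunP => c; have [ca|ca] := boolP (c \in t s a.1).
  rewrite ex_outside -?tb ?dis' //.
  apply: ex_local => // e /dis' eb; by rewrite ex_outside.
rewrite [RHS]ex_outside ?ta //.
have [cb|cb] := boolP (c \in t s b.1); last first.
  by rewrite !ex_outside // -tb.
apply/esym/ex_local => // e; rewrite tb => eb; rewrite ex_outside //.
by move/hasPn: dis; apply.
Qed.

(** Exchange argument: an action in the front commutes with all earlier ones, hence can be performed
    first. An anchor that newly enters the front was held back by [d] only, so its support meets
    that of [d]; this is why requeuing such anchors suffices. *)
Lemma front_pop s w d : d \in front s w ->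
  exists p w', [/\ size w = (size w').+1, run (ex (d, p) s) w' = run s w &
    forall b, b \in front (ex (d, p) s) w' ->
      b \in front s w \/ has [in t s d] (t (ex (d, p) s) b)].
Proof.
elim: w s => [//|[a pa] w IH] s /=; rewrite inE => /predU1P[->|].
  exists pa, w; split=> // b bw.
  case: (boolP (has [in t s a] (t (ex (a, pa) s) b))) => hb; first by right.
  by left; rewrite inE mem_filter hb bw orbT.
rewrite mem_filter => /andP[dis /IH[p [w' [sz rn fr]]]].
set s1 := ex (a, pa) s in dis rn fr *.
have comm : ex (d, p) s1 = ex (a, pa) (ex (d, p) s) by apply: ex_comm.
have td : t s d = t s1 d by apply: (t_ex_disjoint (a := (a, pa))).
have ta : t (ex (d, p) s) a = t s a.
  apply: t_disjoint_ex; rewrite /= td; apply/hasPn => c ca /=.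
  by apply/negP => cd; move/hasPn: dis => /(_ _ cd); rewrite /= ca.
exists p, ((a, pa) :: w'); split=> /=; rewrite -?comm ?sz //.
move=> b; rewrite inE => /predU1P[->|]; first by left; rewrite inE eqxx.
rewrite ta mem_filter => /andP[disb /fr bw].
have tb : t (ex (d, p) s) b = t (ex (d, p) s1) b.
  by rewrite comm; apply: (t_ex_disjoint (a := (a, pa))); rewrite /= ta -comm.
rewrite td tb.
have [hb|hb] := boolP (has [in t s1 d] (t (ex (d, p) s1) b)); first by right.
left; case: bw => [bw|]; last by rewrite (negbTE hb).
rewrite inE mem_filter bw andbT; apply/orP; right.
by rewrite (t_ex_disjoint (s := s1) (a := (d, p))).
Qed.

(** The queue always contains the front, and [size q + C * size w] is a potential: every symbol
    removes the head, and a performed action pays for the at most [C] anchors that it queues. *)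
Lemma decode_queue M s q w : inv s -> {subset front s w <= q} ->
  size q + C * size w <= M ->
  exists2 bs : seq (option P), size bs = M & decode s q bs = run s w.
Proof.
elim: M s q w => [|M IH] s q w invs fq szM.
  exists [::] => //; move: szM; rewrite leqn0 addn_eq0 muln_eq0.
  by case: w {fq} => //= a w; rewrite (gtn_eqF C_gt0) andbF.
(* A nonempty [w] has its first anchor in the front, so an empty queue forces [w] to be empty; the
   remaining symbols are padding. *)
case: q fq szM => [|d q] fq szM.
  exists (nseq M.+1 None); rewrite ?size_nseq //=.
  by case: w fq {szM} => // a w /(_ a.1); rewrite /= inE eqxx => /(_ isT).
have [dw|dw] := boolP (d \in front s w); last first.
  have [||bs sz dec] := IH s q w invs; first 2 last.
  - by exists (None :: bs); rewrite /= ?sz.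
  - move=> b bw; have := fq b bw; rewrite inE => /predU1P[bd|//].
    by rewrite bd (negbTE dw) in bw.
  - by move: szM; rewrite /= addSn ltnS.
have [p [w' [szw rn fr]]] := front_pop dw.
set s' := ex (d, p) s in rn fr.
have invs' : inv s' by apply: inv_ex.
have [||bs sz dec] :=
  IH s' (q ++ enum [set i | has [in t s d] (t s' i)]) w' invs'; first 2 last.
- by exists (Some p :: bs); rewrite /= ?sz // dec rn.
- have mem_new b : has [in t s d] (t s' b) ->
      b \in q ++ enum [set i | has [in t s d] (t s' i)].
    by move=> hb; rewrite mem_cat mem_enum inE hb orbT.
  move=> b /fr[bw|]; last exact: mem_new.
  have := fq b bw; rewrite inE => /predU1P[bd|bq]; last by rewrite mem_cat bq.
  (* The head [d] itself may be needed again; it is requeued because it lies in its own support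
     before and after the action. *)
  apply: mem_new; rewrite bd; apply/hasP; exists d => //=; exact: t_anchor.
rewrite size_cat -cardE; have := t_sparse s d invs'.
move: szM; rewrite szw mulnS /= addSn ltnS => szM le_new.
by apply: leq_trans szM; rewrite -addnA leq_add2l leq_add2r.
Qed.

(** Starting with every anchor in the queue covers the front of any [w]. *)
Lemma decode_run M s w : inv s -> #|D| + C * size w <= M ->
  exists bs : M.-tuple (option P), decode s (enum D) bs = run s w.
Proof.
move=> invs szM; have [||bs sz dec] := @decode_queue M s (enum D) w invs.
- by move=> b _; rewrite mem_enum.
- by rewrite -cardE.
by have bsP : size bs == M by [apply/eqP]; exists (Tuple bsP).
Qed.

End LocalRewriting.

(** * Flips as local rewriting of darts *)

Section DartMemory.

Variables (D L : finType) (twin : D -> D).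
Hypothesis twinK : involutive twin.

(** A dart stores its successor on its face boundary and the vertex where it ends. Twins never
    change, so the origin of a dart is read off its twin. *)
Let state := {ffun D -> D * L}.
Implicit Types (s : state) (i c : D).

Definition succ s i := (s i).1.
Definition target s i := (s i).2.
Definition label s i := (target s (twin i), target s i).

(* A flip of the edge [{i, twin i}] with a triangle at [i] only reads and writes
   these darts: the other face at the edge has size at most four. *)
Definition zone_maps s : seq (D -> D) :=
  [:: id; succ s; succ s \o succ s;
      twin; succ s \o twin; succ s \o succ s \o twin;
      succ s \o succ s \o succ s \o twin].

Definition zone s i : seq D := [seq g i | g <- zone_maps s].

Definition flip_code := ('I_7 * 'I_7 * 'I_7)%type.

(* The code [(l, p, q)] names, as positions in [zone s i], the
   predecessor of [twin i] in its face and the two darts after which the new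
   edge is inserted.  Exchanging the successors of two pairs of darts turns
   the edge [{i, twin i}] into an isolated 2-cycle; exchanging those of two
   further pairs splices it back. *)
Definition flip_mem (a : D * flip_code) s : state :=
  let: (i, (l, p, q)) := a in
  let j := twin i in
  let pos (k : 'I_7) := nth i (zone s i) k in
  let detach c := tperm (pos l) i (tperm (succ s (succ s i)) j c) in
  let attach c := tperm (pos p) j (tperm (pos q) i c) in
  [ffun c => (succ s (detach (attach c)),
              if c == i then target s (pos q)
              else if c == j then target s (pos p) else target s c)].

Lemma zone_anchor s i : i \in zone s i.
Proof. exact: mem_head. Qed.

Lemma mem_pos s i (k : 'I_7) : nth i (zone s i) k \in zone s i.
Proof. by rewrite mem_nth. Qed.

Lemma mem_succ2 s i : succ s (succ s i) \in zone s i.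
Proof. by rewrite !inE eqxx !orbT. Qed.

Lemma mem_twin s i : twin i \in zone s i.
Proof. by rewrite !inE eqxx !orbT. Qed.

Lemma tperm_notin (A : seq D) x y c :
  x \in A -> y \in A -> c \notin A -> tperm x y c = c.
Proof.
move=> xA yA cA; apply: tpermD.
  by apply: contraNneq cA => <-.
by apply: contraNneq cA => <-.
Qed.

Lemma mem_tperm (A : seq D) x y c :
  x \in A -> y \in A -> c \in A -> tperm x y c \in A.
Proof. by case: tpermP => [->|->|]. Qed.

Lemma flip_mem_outside a s c : c \notin zone s a.1 -> flip_mem a s c = s c.
Proof.
case: a => i [[l p] q] /= ci; rewrite /flip_mem ffunE.
have := zone_anchor s i; have := mem_pos s i; have := mem_succ2 s i.
have := mem_twin s i.
move: (zone s i) ci => A ci jA i2A pA iA.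
rewrite !(tperm_notin (A := A)) //.
have -> : (c == i) = false by apply: contraNF ci => /eqP->.
have -> : (c == twin i) = false by apply: contraNF ci => /eqP->.
by rewrite /succ /target; case: (s c).
Qed.

(** Every dart of the zone arises from [i] or [twin i] by successor steps taken inside the zone. *)
Lemma zone_local s s' i : {in zone s i, s =1 s'} ->
  zone s' i = zone s i.
Proof.
move=> ss'; have E c : c \in zone s i -> succ s' c = succ s c.
  by move=> /ss'; rewrite /succ => ->.
have e1 := E i (zone_anchor s i).
have e2 := E (twin i) (mem_twin s i).
have e3 : succ s' (succ s i) = succ s (succ s i).
  by apply: E; rewrite !inE eqxx !orbT.
have e4 : succ s' (succ s (twin i)) = succ s (succ s (twin i)).
  by apply: E; rewrite !inE eqxx !orbT.
have e5 : succ s' (succ s (succ s (twin i))) = succ s (succ s (succ s (twin i))).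
  by apply: E; rewrite !inE eqxx !orbT.
by rewrite /zone /= e1 e3 e2 e4 e5.
Qed.

Lemma flip_mem_local s s' a : {in zone s a.1, s =1 s'} ->
  {in zone s a.1, flip_mem a s =1 flip_mem a s'}.
Proof.
case: a => i [[l p] q] /= ss' c ci; rewrite /flip_mem !ffunE.
rewrite (zone_local ss').
have succE e : e \in zone s i -> succ s' e = succ s e.
  by move=> /ss'; rewrite /succ => ->.
have targetE e : e \in zone s i -> target s' e = target s e.
  by move=> /ss'; rewrite /target => ->.
rewrite (succE i) ?zone_anchor // (succE (succ s i)); last first.
  by rewrite !inE eqxx !orbT.
rewrite !targetE ?mem_pos // succE //.
by rewrite !(mem_tperm, mem_pos, zone_anchor, mem_succ2, mem_twin).
Qed.

(** The new successor map is the old one after a permutation. This holds for every code, so the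
    invariant survives reordered sequences whose intermediate embeddings are degenerate. *)
Lemma flip_mem_inj a s : injective (succ s) -> injective (succ (flip_mem a s)).
Proof.
case: a => i [[l p] q] sI c c'; rewrite /flip_mem /succ !ffunE /=.
by move=> /sI/perm_inj/perm_inj/perm_inj/perm_inj.
Qed.

(** Union bound: under an injective map, [A] has at most [size A] preimages. [List.In] is used since
    functions have no decidable equality. *)
Lemma card_meet (gs : seq (D -> D)) (A : seq D) :
  (forall g, List.In g gs -> injective g) ->
  #|[set i | has [in A] [seq g i | g <- gs]]| <= size gs * size A.
Proof.
elim: gs => [|g gs IH] gI /=.
  by rewrite leqn0 cards_eq0; apply/eqP/setP => i; rewrite !inE.
have -> : [set i | (g i \in A) || has [in A] [seq h i | h <- gs]]
    = [set i | g i \in A] :|: [set i | has [in A] [seq h i | h <- gs]].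
  by apply/setP => i; rewrite !inE.
apply: leq_trans (leq_card_setU _ _) _; rewrite mulSn leq_add ?IH //.
  rewrite -(card_imset _ (gI g (or_introl erefl))).
  apply: leq_trans (card_size A); apply/subset_leq_card/subsetP.
  by move=> _ /imsetP[i iA ->]; rewrite inE in iA.
by move=> h hs; apply: gI; right.
Qed.

(** 49 is the product of the seven maps defining a zone and the seven darts in one. *)
Lemma zone_sparse s s' d : injective (succ s') ->
  #|[set i | has [in zone s d] (zone s' i)]| <= 49.
Proof.
move=> sI; have tI := can_inj twinK.
apply: (@card_meet (zone_maps s') (zone s d)) => g.
have s2I := inj_comp sI sI.
case=> [<-|[<-|[<-|[<-|[<-|[<-|[<-|//]]]]]]].
- exact: inj_id.
- exact: sI.
- exact: s2I.
- exact: tI.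
- exact: inj_comp sI tI.
- exact: inj_comp sI (inj_comp sI tI).
- exact: inj_comp sI (inj_comp sI (inj_comp sI tI)).
Qed.

End DartMemory.

(** * Simulating flips of embeddings in the dart memory *)

Section Simulation.

Variables (D : finType) (n : nat) (twin : D -> D).
Hypothesis twinK : involutive twin.
Implicit Types (T : cppt n) (s : {ffun D -> D * 'I_n}) (i c k : D).

Local Notation lab := (label twin).

(** Makes [lab s] an isomorphism from the memory to the dart structure of [T]: the permanent dart
    [k] currently occupies [lab s k]. *)
Definition represents s T : Prop :=
  [/\ injective (succ s), injective (lab s), (forall k, adj T (lab s k)),
      (forall d, adj T d -> exists k, lab s k = d) &
      (forall k, lab s (succ s k) = phi T (lab s k))].

Lemma lab_twin s k : lab s (twin k) = ((lab s k).2, (lab s k).1).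
Proof. by rewrite /label twinK. Qed.

Lemma lab_iter s T m k : represents s T ->
  lab s (iter m (succ s) k) = iter m (phi T) (lab s k).
Proof. by case=> _ _ _ _ sP; elim: m => //= m IH; rewrite sP IH. Qed.

Lemma mem_face_lab s T i k : represents s T ->
  (lab s k \in face T (lab s i)) = fconnect (succ s) i k.
Proof.
move=> rT; have [sI lI lA lS sP] := rT; rewrite inE lA /=.
apply/idP/idP => /iter_findex; last first.
  by move=> <-; rewrite (lab_iter _ _ rT); apply: fconnect_iter.
rewrite -(lab_iter _ _ rT) => /lI <-; exact: fconnect_iter.
Qed.

Lemma card_face_lab s T i : represents s T ->
  #|face T (lab s i)| = order (succ s) i.
Proof.
move=> rT; have [sI lI lA lS sP] := rT.
rewrite /order -(card_imset _ lI); apply: eq_card => d.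
apply/idP/imsetP => [dF|[k ik ->]]; last by rewrite mem_face_lab.
have [k kd] : exists k, lab s k = d.
  by apply: lS; move: dF; rewrite inE => /andP[].
by exists k => //; rewrite -kd mem_face_lab in dF.
Qed.

Lemma face_connect s T i k : represents s T -> fconnect (succ s) i k ->
  face T (lab s i) = face T (lab s k).
Proof.
move=> rT ik; have [sI _ _ lS _] := rT; apply/setP => d.
have [/lS[c <-]|dT] := boolP (adj T d); last by rewrite !inE (negbTE dT).
by rewrite !mem_face_lab // (same_connect (fconnect_sym sI) ik).
Qed.

Lemma zone_pos s i c : c \in zone twin s i ->
  exists l : 'I_7, nth i (zone twin s i) l = c.
Proof.
move=> cs; have ls : index c (zone twin s i) < 7 by rewrite -index_mem in cs.
by exists (Ordinal ls); rewrite nth_index.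
Qed.

(** The two faces at the flipped edge have three and at most four darts, all in the zone, so the
    darts required by the code have positions there. Detaching then realizes [nxt_del], and
    attaching realizes [nxt_flip]. *)
Lemma flip_represents s T T' : represents s T -> flip T T' ->
  exists a, represents (flip_mem twin a s) T'.
Proof.
move=> rT [u [v [x [y [a [b]]]]]] /= [[ppT adjuv [DO FO DF cD]]].
move=> [[xy adjxy aR bR] [[adjT' nxtT' _ _ _] [[_ symT' _ _] _ _ _]]].
have [[_ symT _ _] szT _ _] := ppT.
have [sI lI lA lS sP] := rT.
have [i iE] := lS _ adjuv; set j := twin i.
have jE : lab s j = (v, u) by rewrite lab_twin iE.
have adjvu : adj T (v, u) by rewrite -jE.
have nij : ~~ fconnect (succ s) i j.
  by apply: contraNN DF => /(face_connect rT); rewrite iE jE => ->.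
have oi : order (succ s) i = 3 by rewrite -(card_face_lab i rT) iE.
have oj : order (succ s) j = 3 \/ order (succ s) j = 4.
  rewrite -(card_face_lab j rT) jE; apply: (szT _ _ FO).2.
  by apply/imsetP; exists (v, u); rewrite ?inE.
(* In a triangle the predecessor of [i] is two steps ahead; only the predecessor of [j] has to be
   named by the code. *)
pose i2 := succ s (succ s i).
have i2E : succ s i2 = i by have := iter_order sI i; rewrite oi.
have orbi c : fconnect (succ s) i c -> c \in zone twin s i.
  by rewrite fconnect_orbit /orbit oi !inE => /or3P[] /eqP->; rewrite eqxx ?orbT.
have orbj c : fconnect (succ s) j c -> c \in zone twin s i.
  have zj m : m < 4 -> iter m (succ s) j \in zone twin s i.
    by case: m => [|[|[|[|//]]]] _; rewrite !inE eqxx ?orbT.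
  rewrite fconnect_orbit => /trajectP[m lt_m ->]; apply: zj.
  by case: oj lt_m => -> // /ltnW.
have [jl jjl jlE] : exists2 jl, fconnect (succ s) j jl & succ s jl = j.
  exists (finv (succ s) j); last exact: f_finv.
  exact: fconnect_finv.
have R_dart d : d \in (face T (u, v) :|: face T (v, u)) :\: [set (u, v); (v, u)] ->
    exists c, [/\ lab s c = d, c \in zone twin s i, c != i & c != j].
  rewrite -iE -jE => /setDP[dF]; rewrite !inE negb_or => /andP[di dj].
  have [c cd] : exists c, lab s c = d.
    by apply: lS; case/setUP: dF; rewrite inE => /andP[].
  rewrite -{}cd in dF di dj *; exists c; split=> //.
  - by move: dF; rewrite inE !mem_face_lab // => /orP[/orbi|/orbj].
  - by apply: contraNneq di => ->.
  - by apply: contraNneq dj => ->.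
have [da [daE das dai daj]] := R_dart _ aR.
have [db [dbE dbs dbi dbj]] := R_dart _ bR.
have [l lE] := zone_pos (orbj _ jjl).
have [p pE] := zone_pos das.
have [q qE] := zone_pos dbs.
have ij : i != j by apply: contraNneq nij => <-; apply: connect0.
have ii2 : fconnect (succ s) i i2 by apply: (fconnect_iter _ 2).
have i2i : i2 != i.
  have := orbit_uniq (succ s) i; rewrite /orbit oi /= !inE negb_or eq_sym.
  by rewrite (eq_sym i i2) => /andP[/andP[]].
have i2j : i2 != j by apply: contraNneq nij => <-.
have i2jl : i2 != jl.
  apply: contraNneq nij => e; rewrite (fconnect_sym sI) in jjl.
  by apply: connect_trans ii2 _; rewrite e.
have jli : jl != i.
  by apply: contraNneq nij => <-; rewrite (fconnect_sym sI).
have jlj : jl != j.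
  have := orbit_uniq (succ s) j; apply: contraTneq => e; rewrite e in jlE.
  by case: oj => oj; rewrite /orbit oj /= jlE mem_head.
have dab : da != db by apply: contra_neq xy => e; move: dbE; rewrite -e daE => -[].
(* The successor once the edge is detached: [i] and [j] form a 2-cycle, and the other darts follow
   [nxt_del]. *)
pose cut c := succ s (tperm jl i (tperm i2 j c)).
have cut_i : cut i = j.
  by rewrite /cut (tpermD i2i) ?tpermR // eq_sym.
have cut_j : cut j = i by rewrite /cut tpermR (tpermD (z := i2)) // eq_sym.
have cut_inj : injective cut by move=> c c' /sI/perm_inj/perm_inj.
have cut_lab c : c != i -> c != j ->
    lab s (cut c) = ((lab s c).2, nxt_del T u v (lab s c).2 (lab s c).1).
  move=> ci cj; rewrite /cut /nxt_del.
  have succE k : lab s (succ s k)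
      = ((lab s k).2, nxt T ((lab s k).2, (lab s k).1)) := sP k.
  (* Deleting the edge affects just the predecessors [i2] of [i] and [jl] of [j], whose successors
     skip the edge. *)
  have [->|ci2] := eqVneq c i2.
    rewrite tpermL (tpermD jlj ij).
    have e1 : (lab s i2).2 = u by have := succE i2; rewrite i2E iE => -[-> _].
    have e2 : nxt T (u, (lab s i2).1) = v.
      by have := succE i2; rewrite i2E iE e1 => -[->].
    by rewrite e1 e2 !eqxx succE jE.
  have [->|cjl] := eqVneq c jl.
    have vu : (v == u) = false.
      by apply: contraNF ij => /eqP vu; apply/eqP/lI; rewrite iE jE vu.
    have -> : tperm i2 j jl = jl by rewrite tpermD // eq_sym.
    have e1 : (lab s jl).2 = v by have := succE jl; rewrite jlE jE => -[-> _].
    have e2 : nxt T (v, (lab s jl).1) = u.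
      by have := succE jl; rewrite jlE jE e1 => -[->].
    by rewrite tpermL e1 e2 vu !eqxx succE iE.
  have -> : tperm jl i (tperm i2 j c) = c.
    by rewrite (tpermD (z := c)) ?(tpermD (z := c)) // eq_sym.
  rewrite succE; case: ifP => [/andP[/eqP e1 /eqP e2]|_].
    case/eqP: ci2; apply/sI/lI; rewrite i2E succE iE e1.
    by rewrite e2.
  case: ifP => [/andP[/eqP e1 /eqP e2]|//].
  by case/eqP: cjl; apply/sI/lI; rewrite jlE succE jE e1 e2.
exists (i, (l, p, q)); set s' := flip_mem _ _ _.
(* As [cut] exchanges [i] and [j], sending [da] to [j] and [db] to [i] makes [i] follow [da] and [j]
   follow [db]. *)
pose splice c := tperm da j (tperm db i c).
have s'E c : s' c = (cut (splice c),
    if c == i then y else if c == j then x else target s c).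
  rewrite /s' /flip_mem ffunE lE pE qE -/j.
  by have := daE; have := dbE; rewrite /label => -[_ ->] -[_ ->].
have splice_da : splice da = j.
  by rewrite /splice (tpermD (z := da)) ?tpermL // eq_sym.
have splice_db : splice db = i.
  by rewrite /splice tpermL tpermD // eq_sym.
have splice_i : splice i = db by rewrite /splice tpermR tpermD // eq_sym.
have splice_j : splice j = da.
  by rewrite /splice (tpermD dbj ij) tpermR.
have splice_id c : c != i -> c != j -> c != da -> c != db -> splice c = c.
  by move=> *; rewrite /splice (tpermD (z := c)) ?(tpermD (z := c)) // eq_sym.
have s'_i : lab s' i = (x, y).
  by rewrite /label /target !s'E /= !eqxx -/j eq_sym (negbTE ij).
have s'_j : lab s' j = (y, x) by rewrite lab_twin s'_i.
have s'_id c : c != i -> c != j -> lab s' c = lab s c.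
  move=> ci cj; rewrite /label /target !s'E /= (negbTE ci) (negbTE cj).
  rewrite (inj_eq (can_inj twinK)) (negbTE ci).
  have -> // : (twin c == i) = false.
  by rewrite -[i]twinK (inj_eq (can_inj twinK)); apply: negbTE.
have adjyx : adj T (y, x) = false by rewrite symT.
(* Since [x] and [y] were not adjacent, the labels given to [i] and [j] are new; this yields
   injectivity and settles the overlapping cases of [nxt_flip]. *)
have xy_lab c : lab s c != (x, y) by apply: contraFneq adjxy => <-.
have yx_lab c : lab s c != (y, x) by apply: contraFneq adjyx => <-.
have lab_uv c : (lab s c == (u, v)) = (c == i) by rewrite -iE (inj_eq lI).
have lab_vu c : (lab s c == (v, u)) = (c == j) by rewrite -jE (inj_eq lI).
have s'A c : adj T' (lab s' c).
  have [->|ci] := eqVneq c i.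
    rewrite s'_i adjT' !eqxx; case: ifP => // /orP[]/eqP e.
      by rewrite e adjuv in adjxy.
    by rewrite e adjvu in adjxy.
  have [->|cj] := eqVneq c j.
    rewrite s'_j adjT' !eqxx orbT; case: ifP => // /orP[]/eqP e.
      by rewrite e adjuv in adjyx.
    by rewrite e adjvu in adjyx.
  by rewrite s'_id // adjT' lab_uv lab_vu (negbTE ci) (negbTE cj) lA if_same.
split=> //.
- exact: flip_mem_inj.
- move=> c c'.
  have [->|ci] := eqVneq c i; have [->|c'i] := eqVneq c' i => //.
  + rewrite s'_i; have [->|c'j] := eqVneq c' j.
      by rewrite s'_j => -[e _]; rewrite e eqxx in xy.
    by rewrite s'_id // => /esym/eqP; rewrite (negbTE (xy_lab _)).
  + rewrite s'_i; have [->|cj] := eqVneq c j.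
      by rewrite s'_j => -[e _]; rewrite e eqxx in xy.
    by rewrite s'_id // => /eqP; rewrite (negbTE (xy_lab _)).
  have [->|cj] := eqVneq c j; have [->|c'j] := eqVneq c' j => //.
  + by rewrite s'_j s'_id // => /esym/eqP; rewrite (negbTE (yx_lab _)).
  + by rewrite s'_j s'_id // => /eqP; rewrite (negbTE (yx_lab _)).
  by rewrite !s'_id // => /lI.
- move=> d; rewrite adjT'; case: ifP => // /norP[duv dvu].
  case: ifP => [/orP[]/eqP-> _|_]; [by exists i|by exists j|].
  move=> /lS[c cd]; exists c; rewrite s'_id // ?cd //.
    by rewrite -lab_uv cd.
  by rewrite -lab_vu cd.
have s'P c : phi T' (lab s' c) =
    ((lab s' c).2, nxt_flip T u v x y a b (lab s' c).2 (lab s' c).1).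
  by rewrite /phi nxtT' // symT' -surjective_pairing.
have cutN c : c != i -> c != j -> (cut c != i) /\ (cut c != j).
  move=> ci cj.
  by split; [rewrite -cut_j | rewrite -cut_i]; rewrite (inj_eq cut_inj).
move=> c; rewrite s'P; have -> : succ s' c = cut (splice c) by rewrite /succ s'E.
have [->|ci] := eqVneq c i.
  have [? ?] := cutN _ dbi dbj.
  rewrite splice_i s'_i s'_id ?cut_lab ?dbE //.
  rewrite /nxt_flip /= !eqxx (eq_sym y x) (negbTE xy) /=.
  case: eqP => // xb; by rewrite -xb in dbE; have := xy_lab db; rewrite dbE eqxx.
have [->|cj] := eqVneq c j.
  have [? ?] := cutN _ dai daj.
  rewrite splice_j s'_j s'_id ?cut_lab ?daE //.
  rewrite /nxt_flip /= !eqxx /=.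
  case: eqP => // ya; by rewrite -ya in daE; have := yx_lab da; rewrite daE eqxx.
rewrite (s'_id c) //; have [->|cda] := eqVneq c da.
  by rewrite splice_da cut_j s'_i daE /nxt_flip /= !eqxx.
have [->|cdb] := eqVneq c db.
  by rewrite splice_db cut_i s'_j dbE /nxt_flip /= !eqxx eq_sym (negbTE xy).
have [cci ccj] := cutN c ci cj.
rewrite splice_id // s'_id // cut_lab // /nxt_flip.
have lab_neq d e1 e2 : lab s d = (e1, e2) -> c != d ->
    ((lab s c).2 == e2) && ((lab s c).1 == e1) = false.
  move=> dE; apply: contraNF => /andP[/eqP e2E /eqP e1E]; apply/eqP/lI.
  by rewrite dE -e1E -e2E -surjective_pairing.
have lab_neq' e1 e2 : (forall d, lab s d != (e1, e2)) ->
    ((lab s c).2 == e2) && ((lab s c).1 == e1) = false.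
  move=> dE; apply: contraNF (dE c) => /andP[/eqP e2E /eqP e1E].
  by rewrite -e1E -e2E -surjective_pairing.
by rewrite (lab_neq _ _ _ daE cda) (lab_neq _ _ _ dbE cdb)
  (lab_neq' _ _ xy_lab) (lab_neq' _ _ yx_lab).
Qed.

End Simulation.

(** The neighbour after [w] around [v] is the end of the successor of the dart [(w, v)], which the
    memory stores. *)
Lemma represents_rotation (D : finType) n (twin : D -> D) s (T T' : cppt n) :
  involutive twin -> represents twin s T -> represents twin s T' ->
  forall v w, adj T (v, w) -> nxt T (v, w) = nxt T' (v, w).
Proof.
move=> twinK [_ _ _ lS sP] [_ _ _ _ sP'] v w vw; have [k kE] := lS _ vw.
have /(congr1 snd) := etrans (esym (sP (twin k))) (sP' (twin k)).
by rewrite lab_twin // kE.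
Qed.

Lemma flip_seq_represents (D : finType) n (twin : D -> D) s (A B : cppt n) k :
  involutive twin -> flip_seq A B k -> represents twin s A ->
  exists2 w, size w = k & represents twin (run (@flip_mem _ _ twin) s w) B.
Proof.
move=> twinK AB; elim: AB s => [T s rT|T T' T'' m fl _ IH s rT].
  by exists [::].
have [a rT'] := flip_represents twinK rT fl.
by have [w <- rw] := IH _ rT'; exists (a :: w).
Qed.

(** * Counting the embeddings reachable from a fixed one *)

Section Counting.

Variables (n : nat) (A : cppt n).
Hypothesis embA : cemb A.

Let D : finType := {d : 'I_n * 'I_n | adj A d}.

Let adj_swap (d : D) : adj A ((val d).2, (val d).1).
Proof. by case: embA => _ symA _ _; rewrite symA -surjective_pairing (valP d). Qed.

Let adj_phi (d : D) : adj A (phi A (val d)).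
Proof. by case: embA => _ _ [nA _ _] _; apply/nA/adj_swap. Qed.

Let twin (d : D) : D := Sub _ (adj_swap d).
Let start : {ffun D -> D * 'I_n} := [ffun d => (Sub _ (adj_phi d), (val d).2)].

Let twinK : involutive twin.
Proof. by move=> d; apply/val_inj; rewrite /= -surjective_pairing. Qed.

Let start_represents : represents twin start A.
Proof.
have labE d : label twin start d = val d.
  by rewrite /label /target !ffunE /= -surjective_pairing.
have succE d : val (succ start d) = phi A (val d) by rewrite /succ ffunE.
split.
- move=> d d' /(congr1 val); rewrite !succE /phi => -[e en].
  apply: val_inj; rewrite [LHS]surjective_pairing [RHS]surjective_pairing e.
  congr pair; case: embA => _ _ [_ nI _] _; apply: (nI (val d').2).
  - by rewrite -e; apply: adj_swap.
  - exact: adj_swap.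
  - by rewrite -en e.
- by move=> d d'; rewrite !labE => /val_inj.
- by move=> d; rewrite labE (valP d).
- by move=> d dA; exists (Sub d dA); rewrite labE.
- by move=> d; rewrite !labE succE.
Qed.

(** Every [B i] is assigned a symbol string of the same length [M]. Equal strings decode to the same
    memory, hence to the same rotation. *)
Lemma reachable_count (I : finType) (B : I -> cppt n) (K : nat) :
  (forall i j,
     (forall v w, adj (B i) (v, w) -> nxt (B i) (v, w) = nxt (B j) (v, w)) ->
     i = j) ->
  (forall i, exists2 k, k <= K & flip_seq A (B i) k) ->
  #|I| <= expn #|{: option flip_code}| (#|darts A| + 49 * K).
Proof.
move=> Binj reach; set M := _ + _.
have coded i : exists bs : M.-tuple (option flip_code),
    represents twin (decode (@zone D 'I_n twin) (@flip_mem D 'I_n twin) start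
      (enum D) bs) (B i).
  have [k kK ABi] := reach i.
  have [w szw rw] := flip_seq_represents twinK ABi start_represents.
  have [||bs bsE] := @decode_run D _ _ (@zone D 'I_n twin)
    (@flip_mem D 'I_n twin) (fun s => injective (succ s)) 49
    (@zone_anchor _ _ twin) (@flip_mem_outside _ _ twin)
    (@zone_local _ _ twin) (@flip_mem_local _ _ twin)
    (fun a s => @flip_mem_inj _ _ twin a s) (zone_sparse twinK) isT M start w.
  - by case: start_represents.
  - rewrite /M szw; apply: leq_add; last by rewrite leq_mul2l kK.
    by rewrite card_sig /darts cardsE.
  by exists bs; rewrite bsE.
have [code codeP] := fin_all_exists coded.
rewrite -card_tuple; apply: (leq_card code) => i j e.
by apply: Binj; apply: represents_rotation twinK (codeP i) _; rewrite e.
Qed.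

End Counting.

(** * Nested vertices of degree two *)

Section Relabel.

Variables (n : nat) (p : {perm 'I_n}).
Implicit Types (T : cppt n) (d : 'I_n * 'I_n).

Let q : {perm 'I_n} := (p^-1)%g.
Let push d := (p d.1, p d.2).
Let pull d := (q d.1, q d.2).

Definition relabel T : cppt n :=
  CPPT [ffun d => adj T (pull d)] [ffun d => p (nxt T (pull d))]
       [ffun d => reflex T (pull d)] [set push d | d in outer T].

Let pushK : cancel push pull.
Proof. by case=> a b; rewrite /push /pull /q /= !permK. Qed.

Let pullK : cancel pull push.
Proof. by case=> a b; rewrite /push /pull /q /= !permKV. Qed.

Let push_inj : injective push := can_inj pushK.

Let adjR T d : adj (relabel T) (push d) = adj T d.
Proof. by rewrite ffunE pushK. Qed.

Let reflexR T d : reflex (relabel T) (push d) = reflex T d.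
Proof. by rewrite ffunE pushK. Qed.

(** Conjugating the face permutation carries faces to faces, from which all counts transfer. *)
Lemma phi_relabel T d : phi (relabel T) (push d) = push (phi T d).
Proof. by rewrite /phi ffunE /pull /push /q /= !permK. Qed.

Let fconnectR T d d' :
  fconnect (phi (relabel T)) (push d) (push d') = fconnect (phi T) d d'.
Proof.
have iterR m : iter m (phi (relabel T)) (push d) = push (iter m (phi T) d).
  by elim: m => //= m ->; rewrite phi_relabel.
apply/idP/idP => /iter_findex; rewrite ?iterR; first move=> /push_inj <-.
  exact: fconnect_iter.
by move=> <-; rewrite -iterR fconnect_iter.
Qed.

Let memR (X : {set 'I_n * 'I_n}) d : (push d \in push @: X) = (d \in X).
Proof. exact: mem_imset. Qed.

Let setR (X Y : {set 'I_n * 'I_n}) :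
  (forall d, (push d \in Y) = (d \in X)) -> Y = push @: X.
Proof. by move=> XY; apply/setP => d; rewrite -(pullK d) XY memR. Qed.

Let dartsR T : darts (relabel T) = push @: darts T.
Proof. by apply: setR => d; rewrite !inE adjR. Qed.

Let faceR T d : face (relabel T) (push d) = push @: face T d.
Proof. by apply: setR => d'; rewrite !inE adjR fconnectR. Qed.

Let facesR T : faces (relabel T) = [set push @: X | X : {set _} in faces T].
Proof.
rewrite /faces dartsR -!imset_comp; apply: eq_imset => d /=; exact: faceR.
Qed.

Lemma relabel_cemb T : cemb T -> cemb (relabel T).
Proof.
move=> [irr sym [nA nI nC] [nid con euler out ref]].
split; [by move=> v; rewrite ffunE irr | by move=> u v; rewrite !ffunE sym |
        split | split].
- by move=> v w; rewrite !ffunE /pull /q /= permK => /nA.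
- move=> v w w'; rewrite !ffunE /pull /= => vw vw' /perm_inj/(nI _ _ _ vw vw').
  exact: perm_inj.
- move=> v w w'; rewrite !ffunE /pull /= => vw vw'.
  have /iter_findex e := nC _ _ _ vw vw'.
  have iterR m : iter m (fun z => nxt (relabel T) (v, z)) w
      = p (iter m (fun z => nxt T (q v, z)) (q w)).
    elim: m => [|m /= ->]; first by rewrite /q /= permKV.
    by rewrite ffunE /pull /q /= permK.
  have -> : w' = p (q w') by rewrite /q permKV.
  by rewrite -e -iterR fconnect_iter.
- by move=> v w; rewrite !ffunE /pull /= => /nid ->; rewrite /q permKV.
- move=> u v; have := con (q u) (q v); rewrite -{2}(permKV p u) -{2}(permKV p v).
  rewrite -/q; move: (q u) (q v) => a b /connectP[s us ->].
  elim: s a us => [|c s IH] a /=; first by rewrite connect0.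
  move=> /andP[ac cs]; apply: connect_trans (IH c cs); apply: connect1.
  by rewrite /= -[(p a, p c)]/(push (a, c)) adjR.
- rewrite dartsR facesR (card_imset _ push_inj) (card_imset _ (imset_inj push_inj)).
  exact: euler.
- by rewrite facesR; apply: imset_f.
- by move=> d; rewrite !ffunE => /ref.
Qed.

Lemma relabel_ppt4 T : ppt4 T -> ppt4 (relabel T).
Proof.
move=> [emb szT out one]; split.
- exact: relabel_cemb.
- move=> f; rewrite facesR => /imsetP[X XT ->].
  rewrite (inj_eq (imset_inj push_inj)) => /(szT _ XT).
  rewrite card_imset // => -[c3 c34]; split => //.
  rewrite -c3 -[RHS](card_imset _ push_inj); congr #|pred_of_set _|.
  by apply: setR => d; rewrite !inE memR reflexR.
- by move=> _ /imsetP[d dO ->]; rewrite reflexR out.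
- move=> v; rewrite -(one (q v)) -[RHS](card_imset _ push_inj).
  congr #|pred_of_set _|; apply: setR => d; rewrite !inE adjR reflexR /=.
  by rewrite -(inj_eq (@perm_inj _ q)) /q permK.
Qed.

End Relabel.

(** * The nested 4-PPT *)

Section Nest.

Variable m : nat.
Let n := m.+4.
Implicit Types (u v w k : 'I_n) (d : 'I_n * 'I_n).

Let v0 : 'I_n := @Ordinal n 0 isT.
Let v1 : 'I_n := @Ordinal n 1 isT.
Let v2 : 'I_n := @Ordinal n 2 isT.
Let vmax : 'I_n := @ord_max m.+3.

(* The vertices 0 and 1 are adjacent to each other and to all other vertices;
   2, 3, 4, and so on lie inside one another, 2 being on the outer face.  The
   faces are the outer triangle, the triangle [(0, 1, m.+3)] and, for [k > 2],
   the quadrangle [(0, k, 1, k - 1)], whose reflex angle is at [k]. *)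
Definition nest_adj (u v : nat) : bool := (u != v) && ((u <= 1) || (v <= 1)).

(** The orders around 0 and 1 are opposite, as planarity of the nesting demands; [1 - w] exchanges
    the only two neighbours of any other vertex. *)
Definition nest_nxt (v w : nat) : nat :=
  if ~~ nest_adj v w then w
  else if v == 0 then if w == m.+3 then 1 else w.+1
  else if v == 1 then
    if w == 0 then m.+3 else if w == 2 then 0 else w.-1
  else 1 - w.

Definition nest_reflex (u v : nat) : bool :=
  [|| (u == 0) && (1 < v), (u == 1) && (v == 0) | (u == 2) && (v == 1)].

Definition nest : cppt n :=
  CPPT [ffun d : 'I_n * 'I_n => nest_adj d.1 d.2]
       [ffun d : 'I_n * 'I_n => inord (nest_nxt d.1 d.2)]
       [ffun d : 'I_n * 'I_n => nest_reflex d.1 d.2]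
       [set (v0, v2); (v2, v1); (v1, v0)].

Let nxtE v w : nxt nest (v, w) = nest_nxt v w :> nat.
Proof.
rewrite ffunE inordK //= /nest_nxt /nest_adj.
have := ltn_ord v; have := ltn_ord w; rewrite /n; do ?case: ifPn; lia.
Qed.

Let adjE d : adj nest d = nest_adj d.1 d.2.
Proof. by rewrite ffunE. Qed.

Let reflexE d : reflex nest d = nest_reflex d.1 d.2.
Proof. by rewrite ffunE. Qed.

Let down k : 'I_n := inord k.-1.

Let downE k : down k = k.-1 :> nat.
Proof. by rewrite inordK //; have := ltn_ord k; rewrite /n; lia. Qed.

(* The boundary walk of the face containing the dart [(0, k)]. *)
Definition nest_face k : seq ('I_n * 'I_n) :=
  if k == v1 then [:: (v0, v1); (v1, vmax); (vmax, v0)]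
  else if k == v2 then [:: (v0, v2); (v2, v1); (v1, v0)]
  else [:: (v0, k); (k, v1); (v1, down k); (down k, v0)].

(** Faces are indexed by their dart leaving 0. The darts [(1, j)] and [(j, 0)] lie in the face of
    [j + 1], apart from the wrap-around at 0 and at the largest vertex. *)
Let face_of d : 'I_n :=
  let: (u, v) := d in
  if u == v0 then v else if v == v1 then u
  else let j := if u == v1 then v else u in
       if j == v0 then v2 else if j == vmax then v1 else inord j.+1.

Let ltnm k : k < m.+4.
Proof. exact: ltn_ord. Qed.

Let phiE u v w : nest_nxt v u = w -> phi nest (u, v) = (v, w).
Proof. by move=> e; congr pair; apply: val_inj; rewrite /= nxtE. Qed.

Let nest_face_cycle k : k != v0 -> fcycle (phi nest) (nest_face k).
Proof.
rewrite /nest_face => k0.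
case: eqVneq => [_|k1].
  have e1 : phi nest (v0, v1) = (v1, vmax) by apply: phiE.
  have e2 : phi nest (v1, vmax) = (vmax, v0) by apply: phiE.
  have e3 : phi nest (vmax, v0) = (v0, v1).
    by apply: phiE; rewrite /nest_nxt /= eqxx.
  by rewrite /= e1 e2 e3 !eqxx.
case: eqVneq => [_|k2].
  have e1 : phi nest (v0, v2) = (v2, v1) by apply: phiE.
  have e2 : phi nest (v2, v1) = (v1, v0) by apply: phiE.
  have e3 : phi nest (v1, v0) = (v0, v2) by apply: phiE.
  by rewrite /= e1 e2 e3 !eqxx.
have := ltnm k; move: k0 k1 k2; rewrite -!val_eqE /v0 /v1 /v2 /vmax /= => *.
have e1 : phi nest (v0, k) = (k, v1).
  by apply: phiE; rewrite /nest_nxt /nest_adj /=; do ?case: ifPn; lia.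
have e2 : phi nest (k, v1) = (v1, down k).
  by apply: phiE; rewrite downE /nest_nxt /nest_adj /=; do ?case: ifPn; lia.
have e3 : phi nest (v1, down k) = (down k, v0).
  by apply: phiE; rewrite downE /nest_nxt /nest_adj /=; do ?case: ifPn; lia.
have e4 : phi nest (down k, v0) = (v0, k).
  by apply: phiE; rewrite downE /nest_nxt /nest_adj /=; do ?case: ifPn; lia.
by rewrite /= e1 e2 e3 e4 !eqxx.
Qed.

Let nest_face_adj k d : k != v0 -> d \in nest_face k -> adj nest d.
Proof.
rewrite /nest_face => k0; case: eqVneq => [_|k1].
  by rewrite !inE => /or3P[] /eqP->; rewrite adjE.
case: eqVneq => [_|k2].
  by rewrite !inE => /or3P[] /eqP->; rewrite adjE.
move: k0 k1 k2; rewrite -!val_eqE /v0 /v1 /v2 /vmax /= => k0 k1 k2; rewrite !inE.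
have km := ltnm k; by case/or4P => /eqP->; rewrite adjE /nest_adj /= ?downE; lia.
Qed.

Let face_ofP d : adj nest d -> face_of d != v0 /\ d \in nest_face (face_of d).
Proof.
case: d => u v; rewrite adjE /nest_adj /face_of /nest_face /= => uv.
have um := ltnm u; have vm := ltnm v.
case: (eqVneq u v0) => [u0|u0].
  have v_0 : v != v0 by move: uv; rewrite u0 -!val_eqE /v0 /v1 /v2 /vmax /=; lia.
  split=> //; rewrite u0; case: eqVneq => [->|v_1]; first by rewrite mem_head.
  by case: eqVneq => [->|v_2]; rewrite mem_head.
case: (eqVneq v v1) => [v_1|v_1].
  split=> //; rewrite v_1; case: eqVneq => [u1|u1].
    by move: uv; rewrite u1 v_1.
  by case: eqVneq => [->|u2]; rewrite !inE !xpair_eqE !eqxx ?orbT.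
have succ_face (j : 'I_n) : j != v0 -> j != v1 -> j != vmax ->
    [/\ inord j.+1 != v0, inord j.+1 != v1, inord j.+1 != v2 &
        down (inord j.+1) = j].
  have jm := ltnm j; rewrite -!val_eqE /v0 /v1 /v2 /vmax /= => j0 j1 jx.
  have e : (inord j.+1 : 'I_n) = j.+1 :> nat by rewrite inordK //; lia.
  rewrite e; split; try lia.
  by apply: val_inj; rewrite /= downE e.
case: (eqVneq u v1) => [u1|u1].
  rewrite u1; case: (eqVneq v v0) => [->|v_0]; first by rewrite !inE.
  case: (eqVneq v vmax) => [->|v_x]; first by rewrite !inE eqxx orbT.
  have [e0 e1 e2 e3] := succ_face v v_0 v_1 v_x.
  by rewrite (negbTE e1) (negbTE e2) e3 !inE eqxx !orbT.
have v_0 : v = v0.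
  apply: val_inj => /=; move: u0 u1 v_1.
  by rewrite -!val_eqE /v0 /v1 /v2 /vmax /=; lia.
rewrite v_0 (negbTE u0); case: (eqVneq u vmax) => [->|u_x].
  by rewrite !inE eqxx !orbT.
have [e0 e1 e2 e3] := succ_face u u0 u1 u_x.
by rewrite (negbTE e1) (negbTE e2) e3 !inE eqxx !orbT.
Qed.

Let nest_face_uniq k : k != v0 -> uniq (nest_face k).
Proof.
rewrite /nest_face => k0; case: eqVneq => [_|k1].
  by [].
case: eqVneq => [_|k2].
  by [].
move: k0 k1 k2; rewrite /= !inE !xpair_eqE -!val_eqE /v0 /v1 /v2 /vmax /= !downE.
lia.
Qed.

Let face_nest k d : k != v0 -> d \in nest_face k ->
  face nest d = [set d' in nest_face k].
Proof.
move=> k0 dk; apply/setP => d'; rewrite !inE.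
rewrite (fconnect_cycle (nest_face_cycle k0) dk).
by apply: andb_idl; apply: nest_face_adj.
Qed.

Let head_face k : k != v0 -> (v0, k) \in nest_face k.
Proof.
move=> _; rewrite /nest_face; case: eqVneq => [->|_]; first by rewrite !inE eqxx.
by case: eqVneq => [->|_]; rewrite !inE eqxx.
Qed.

Let faces_nest : faces nest = [set [set d in nest_face k] | k in predC1 v0].
Proof.
apply/setP => f; apply/imsetP/imsetP => [[d]|[k k0 ->]].
  rewrite inE => /face_ofP[k0 dk] ->; exists (face_of d) => //.
  exact: face_nest.
exists (v0, k); first by rewrite inE (nest_face_adj k0) ?head_face.
by rewrite (face_nest k0) ?head_face.
Qed.

Let nest_face_disj k k' : k != v0 -> k' != v0 ->
  [set d in nest_face k] = [set d in nest_face k'] -> k = k'.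
Proof.
move=> k0 k'0 /setP/(_ (v0, k)); rewrite !inE head_face // => /esym mem.
apply: val_inj; move: mem k0 k'0; rewrite /nest_face.
case: eqVneq => [->|k1]; last case: eqVneq => [->|k2]; last move: k1 k2.
- by rewrite !inE !xpair_eqE -!val_eqE /v0 /v1 /v2 /vmax /=; lia.
- by rewrite !inE !xpair_eqE -!val_eqE /v0 /v1 /v2 /vmax /=; lia.
- by rewrite !inE !xpair_eqE -!val_eqE /v0 /v1 /v2 /vmax /= downE; lia.
Qed.

Let card_face k (b : pred ('I_n * 'I_n)) : k != v0 ->
  #|[set d in [set d' in nest_face k] | b d]| = count b (nest_face k).
Proof.
move=> k0; rewrite -size_filter -(card_uniqP (filter_uniq b (nest_face_uniq k0))).
by apply: eq_card => d; rewrite !inE mem_filter andbC.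
Qed.

(** With [n] vertices there are [2n - 3] edges: the one joining 0 and 1, and two for each further
    vertex. *)
Lemma card_nest_darts : #|darts nest| = (m.+4).*2 + (m.+2).*2 - 2.
Proof.
have -> : #|darts nest| = \sum_(u < m.+4) \sum_(v < m.+4) nest_adj u v.
  rewrite pair_bigA /= -sum1_card big_mkcond /=; apply: eq_bigr => d _.
  by rewrite inE adjE; case: nest_adj.
have row u : \sum_(v < m.+4) nest_adj u v
    = nest_adj u 0 + (nest_adj u 1 + \sum_(i < m.+2) nest_adj u i.+2).
  by rewrite !big_ord_recl.
rewrite (eq_bigr _ (fun (u : 'I_m.+4) _ => row u)).
rewrite (big_ord_recl m.+3) (big_ord_recl m.+2) /= /nest_adj /=.
rewrite [X in _ + (_ + X)](eq_bigr (fun=> 2)) => [|i _]; last first.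
  by rewrite big1 // => j _; rewrite andbF.
by rewrite !sum_nat_const !card_ord; lia.
Qed.

Let nest_nxt_inj v : injective (fun w => nxt nest (v, w)).
Proof.
move=> w w' /(congr1 val); rewrite /= !nxtE => e.
apply: val_inj; move: e; rewrite /nest_nxt /nest_adj /=.
have := ltnm v; have := ltnm w; have := ltnm w'; do ?case: ifPn; lia.
Qed.

Let nest_rotation v w w' : adj nest (v, w) -> adj nest (v, w') ->
  fconnect (fun z => nxt nest (v, z)) w w'.
Proof.
pose f z := nxt nest (v, z); rewrite -/f.
have fI : injective f := @nest_nxt_inj v.
have fE z : f z = nest_nxt v z :> nat by rewrite nxtE.
(* Orbits of an injective map are symmetric, so it suffices to reach all neighbours from one of
   them. *)
suff [x fx] : exists x, forall z, adj nest (v, z) -> fconnect f x z.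
  move=> /fx xw /fx xw'; rewrite (fconnect_sym fI) in xw.
  exact: connect_trans xw xw'.
have [v_0|v_0] := eqVneq v v0.
  exists v1 => z; rewrite adjE /nest_adj v_0 /= => z0.
  have iterE j : j < m.+3 -> iter j f v1 = j.+1 :> nat.
    elim: j => //= j IH jm; rewrite fE IH; last by lia.
    by rewrite v_0 /nest_nxt /nest_adj /=; do ?case: ifPn; lia.
  have -> : z = iter z.-1 f v1; last exact: fconnect_iter.
  by apply: val_inj => /=; have zm := ltnm z; rewrite iterE; lia.
have [v_1|v_1] := eqVneq v v1.
  exists v0 => z; rewrite adjE /nest_adj v_1 /= => z1.
  have iterE j : j < m.+2 -> iter j.+1 f v0 = m.+3 - j :> nat.
    elim: j => [|j IH] jm; first by rewrite /= fE v_1.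
    rewrite iterS fE IH; last by lia.
    by rewrite v_1 /nest_nxt /nest_adj /=; do ?case: ifPn; lia.
  have [->|z0] := eqVneq z v0; first exact: connect0.
  have -> : z = iter (m.+3 - z).+1 f v0; last exact: fconnect_iter.
  apply: val_inj => /=; have zm := ltnm z.
  by move: z0; rewrite -val_eqE /v0 /= => z0; rewrite -iterS iterE; lia.
exists v0 => z; rewrite adjE /nest_adj; move: v_0 v_1.
have [->|z0] := eqVneq z v0; first by move=> *; apply: connect0.
rewrite -!val_eqE /v0 /v1 /= => v_0 v_1 vz.
have -> : z = f v0; last exact: fconnect1.
apply: val_inj; move: z0; rewrite /= fE -val_eqE /v0 /= => z0.
by rewrite /nest_nxt /nest_adj /=; do ?case: ifPn; lia.
Qed.

Let adj_hub u : u != v0 -> adj nest (u, v0) && adj nest (v0, u).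
Proof. by rewrite !adjE /nest_adj -val_eqE /v0 /=; lia. Qed.

Lemma nest_cemb : cemb nest.
Proof.
split.
- by move=> v; rewrite adjE /nest_adj eqxx.
- by move=> u v; rewrite !adjE /nest_adj /= eq_sym orbC.
- split.
  + move=> v w; rewrite !adjE /= nxtE /nest_nxt /nest_adj.
    have := ltnm v; have := ltnm w; do ?case: ifPn; lia.
  + by move=> v w w' _ _; apply: nest_nxt_inj.
  + exact: nest_rotation.
- split.
  + move=> v w; rewrite adjE /= => vw; apply: val_inj.
    by rewrite /= nxtE /nest_nxt vw.
  + have to_hub u : connect [rel a b | adj nest (a, b)] u v0.
      have [->|/adj_hub/andP[u0 _]] := eqVneq u v0; first exact: connect0.
      exact: connect1.
    have from_hub u : connect [rel a b | adj nest (a, b)] v0 u.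
      have [->|/adj_hub/andP[_ u0]] := eqVneq u v0; first exact: connect0.
      exact: connect1.
    by move=> u v; apply: connect_trans (to_hub u) (from_hub v).
  (* There are [n - 1] faces, one for each vertex other than 0, and [4n - 6] darts. *)
  + rewrite card_nest_darts faces_nest card_in_imset; last first.
      by move=> k k'; rewrite !inE; apply: nest_face_disj.
    by rewrite cardC1 card_ord /n; lia.
  + rewrite faces_nest; apply/imsetP; exists v2 => //.
    by apply/setP => d; rewrite !inE orbA.
  + move=> [u v]; rewrite adjE reflexE /nest_adj /nest_reflex /=.
    lia.
Qed.

Lemma nest_ppt4 : ppt4 nest.
Proof.
split; first exact: nest_cemb.
- move=> f; rewrite faces_nest => /imsetP[k k0 ->] fO.
  rewrite inE in k0.
  have k2 : k != v2.
    apply: contraNneq fO => ->; apply/eqP/setP => d.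
    by rewrite !inE /= orbA.
  rewrite card_face // cardsE (card_uniqP (nest_face_uniq k0)).
  rewrite /nest_face (negbTE k2); case: eqVneq => [_|k1].
    by rewrite /= !reflexE /=; split; [|left].
  move: k1 k0 k2; rewrite -!val_eqE /v0 /v1 /v2 /= => k1 k0 k2; split; last by right.
  by have := ltnm k; rewrite !reflexE /nest_reflex /= downE; lia.
- by move=> d; rewrite !inE => /orP[/orP[]|] /eqP->; rewrite reflexE.
- move=> v; apply/eqP/cards1P.
  (* The darts carrying the reflex angles at 0 and 1 lie in the outer face, as does the one at 2. *)
  exists (if v == v0 then (v1, v0) else if v == v1 then (v2, v1) else (v0, v)).
  apply/setP => -[a b]; rewrite !inE adjE reflexE /nest_adj /nest_reflex /=.
  case: (eqVneq v v0) => [->|]; last case: (eqVneq v v1) => [->|];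
    rewrite xpair_eqE -!val_eqE /v0 /v1 /v2 /=; lia.
Qed.

End Nest.

Lemma nxt_relabel n (p : {perm 'I_n}) (T : cppt n) v w :
  nxt (relabel p T) (p v, p w) = p (nxt T (v, w)).
Proof. by have /(congr1 snd) := phi_relabel p T (w, v). Qed.

(** * Permuting the inner vertices of the nest *)

Section NestRelabel.

Variable m : nat.
Definition inner_vertices : {set 'I_m.+4} := [set k : 'I_m.+4 | 2 < k].
Local Notation S := inner_vertices.

Let fix_small (p : {perm 'I_m.+4}) (k : 'I_m.+4) :
  perm_on S p -> k <= 2 -> p k = k.
Proof. by move=> pS k2; apply: (out_perm pS); rewrite inE -leqNgt. Qed.

Lemma nest_same_outer (p : {perm 'I_m.+4}) : perm_on S p ->
  same_outer (nest m) (relabel p (nest m)).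
Proof.
move=> pS.
have pushE d : d \in outer (nest m) -> (p d.1, p d.2) = d.
  by rewrite !inE => /orP[/orP[]|] /eqP->; rewrite /= !fix_small.
have outer_phi d : d \in outer (nest m) -> phi (nest m) d \in outer (nest m).
  rewrite !inE => /orP[/orP[]|] /eqP->;
  by rewrite /phi ffunE /= /nest_nxt /= !xpair_eqE -!val_eqE /= inordK.
split.
  rewrite /= -[LHS]imset_id; apply: eq_in_imset => d dO; by rewrite pushE.
by move=> d dO; rewrite -{2}(pushE d dO) phi_relabel pushE ?outer_phi.
Qed.

(** The rotation at the fixed vertex 0, followed from the fixed vertex 2, lists the images of 3, 4,
    and so on in order. *)
Lemma nest_relabel_inj (p p' : {perm 'I_m.+4}) :
  perm_on S p -> perm_on S p' ->
  (forall v w, adj (relabel p (nest m)) (v, w) ->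
     nxt (relabel p (nest m)) (v, w) = nxt (relabel p' (nest m)) (v, w)) ->
  p = p'.
Proof.
move=> pS p'S same; apply/permP => k.
have [k2|k2] := leqP k 2; first by rewrite !fix_small.
have small j : j < 3 -> (inord j : 'I_m.+4) = j :> nat.
  by move=> j3; rewrite inordK //; lia.
suff step j : j.+2 < m.+4 -> p (inord j.+2) = p' (inord j.+2).
  have -> : k = inord k.-2.+2.
    by apply: val_inj; rewrite /= inordK; have := ltn_ord k; lia.
  by apply: step; have := ltn_ord k; lia.
elim: j => [_|j IH jm]; first by rewrite !fix_small // small.
pose w : 'I_m.+4 := inord j.+2; have wE : w = j.+2 :> nat by rewrite inordK; lia.
have nw : nxt (nest m) (ord0, w) = inord j.+3.
  apply: val_inj; rewrite ffunE /= wE; congr val.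
  by rewrite /nest_nxt /nest_adj /= ifN // ltn_eqF.
have pw : p' w = p w by rewrite /w IH //; lia.
have adj0w : adj (relabel p (nest m)) (p ord0, p w).
  by rewrite ffunE /= !permK ffunE /= /nest_adj /= wE.
have := same _ _ adj0w; rewrite nxt_relabel nw.
have -> : p ord0 = p' ord0 by rewrite !fix_small.
by rewrite -pw nxt_relabel nw.
Qed.

Lemma card_perm_on_large : #|[pred p : {perm 'I_m.+4} | perm_on S p]| = m.+1`!.
Proof.
rewrite (card_perm S) cardsE -sum1_card big_mkcond /=.
rewrite (big_ord_recl m.+3) (big_ord_recl m.+2) (big_ord_recl m.+1) /=.
by rewrite (eq_bigr (fun=> 1)) // sum_nat_const card_ord muln1.
Qed.

End NestRelabel.

(** * Logarithmic estimates and the final comparison *)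

(** The last [a] factors of the factorial all exceed [h]. *)
Lemma expn_le_fact h a : expn h a <= (h + a)`!.
Proof.
elim: a => [|a IH]; first by rewrite addn0 expn0 fact_gt0.
by rewrite expnS addnS factS leq_mul // leqW // leq_addr.
Qed.

Lemma INR_expn b e : INR (expn b e) = (INR b ^ e)%R.
Proof. by elim: e => // e IH; rewrite expnS mult_INR IH. Qed.

Lemma INR_leq a b : a <= b -> (INR a <= INR b)%R.
Proof. by move/leP; apply: le_INR. Qed.

Lemma ln_expn b e : 0 < b -> ln (INR (expn b e)) = (INR e * ln (INR b))%R.
Proof. by move=> b0; rewrite INR_expn ln_pow //; apply/lt_0_INR/ltP. Qed.

Lemma ln_INR_leq a b : 0 < a -> a <= b -> (ln (INR a) <= ln (INR b))%R.
Proof.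
move=> a0 ab; case: (Rle_lt_or_eq_dec _ _ (INR_leq ab)) => [lt|->].
  by apply/Rlt_le/ln_increasing => //; apply/lt_0_INR/ltP.
exact: Rle_refl.
Qed.

Lemma ln_fact_lower m : 4 <= m ->
  (INR m.+4 / 4 * (ln (INR m.+4) - ln 4) <= ln (INR m.+1`!))%R.
Proof.
move=> m4; pose h := m.+1./2; pose a := m.+1 - h.
have hE : m.+1 = h + a by rewrite /a /h; lia.
have h0 : 0 < h by rewrite /h; lia.
have := ln_INR_leq (_ : 0 < expn h a) (expn_le_fact h a).
rewrite expn_gt0 h0 -hE ln_expn // => /(_ isT); apply: Rle_trans.
(* Both halves of [m.+1] are at least a quarter of [m.+4]; this is where [4 <= m] enters. *)
have hR : (INR m.+4 <= INR 4 * INR h)%R.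
  by rewrite -mult_INR; apply: INR_leq; rewrite /h; lia.
have aR : (INR m.+4 <= INR 4 * INR a)%R.
  by rewrite -mult_INR; apply: INR_leq; rewrite /a /h; lia.
have e4 : INR 4 = 4%R by rewrite /=; lra.
rewrite e4 in hR aR; have m0 : (0 < INR m.+4)%R by apply: lt_0_INR; apply/ltP.
have hpos : (0 < INR h)%R by apply/lt_0_INR/ltP.
have h1 : (1 <= INR h)%R by apply: (INR_leq (a := 1)).
have lnh : (ln (INR m.+4) <= ln 4 + ln (INR h))%R.
  rewrite -ln_mult //; last by lra.
  case: hR => [lt|->]; last exact: Rle_refl.
  by apply/Rlt_le/ln_increasing.
have lnh0 : (0 <= ln (INR h))%R.
  by rewrite -ln_1; apply: (ln_INR_leq (a := 1)).
nra.
Qed.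

Lemma nest_reachable_count m K :
  (forall p : {perm 'I_m.+4}, perm_on (inner_vertices m) p ->
     exists2 k, k <= K & flip_seq (nest m) (relabel p (nest m)) k) ->
  m.+1`! <= expn #|{: option flip_code}| (4 * m.+4 + 49 * K).
Proof.
move=> reach; pose I := {p : {perm 'I_m.+4} | perm_on (inner_vertices m) p}.
have := @reachable_count _ (nest m) (nest_cemb m) I
  (fun p => relabel (val p) (nest m)) K.
rewrite card_sig card_perm_on_large => count.
apply: leq_trans (count _ _) _.
- by move=> [p pS] [p' p'S] same; apply/val_inj/nest_relabel_inj.
- by move=> [p pS]; apply: reach.
(* The [4n - 6] darts are rounded up to [4n]. *)
rewrite card_nest_darts; apply: leq_pexp2l; last by lia.
by rewrite card_option.
Qed.

Theorem theorem5 :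
  exists c : R, (0 < c)%R /\
  exists N : nat, forall n : nat, (N <= n)%N ->
    exists A B : cppt n,
      [/\ ppt4 A, ppt4 B, same_outer A B &
          forall k : nat, flip_seq A B k ->
            (c * INR n * ln (INR n) <= INR k)%R].
Proof.
pose q := #|{: option flip_code}|.
have q2 : 1 < q by rewrite /q card_option !card_prod !card_ord.
set L := ln (INR q).
have L0 : (0 < L)%R.
  by rewrite -ln_1; apply: ln_increasing; [lra|apply/(lt_INR 1)/ltP].
(* 392 = 8 * 49, so that [49 * L * (c n ln n) = n ln n / 8]. *)
pose c := (/ (392 * L))%R; exists c.
have c0 : (0 < c)%R by apply: Rinv_0_lt_compat; lra.
have cL : (c * L = / 392)%R by rewrite /c; field; lra.
split=> //.
(* The final inequalities force [x <= 2 ln 4 + 8 * (4 + 49) * L], and [8 * 53 = 424]; the constant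
   425 makes this impossible. *)
have [N0 /Rgt_lt/Rlt_le N0P] := INR_unbounded (exp (2 * ln 4 + 425 * L)).
exists (maxn 8 N0) => n; rewrite geq_max => /andP[n8 nN0].
case: n n8 nN0 => [|[|[|[|m]]]] // m4 nN0; exists (nest m).
set n := m.+4; set x := ln (INR n).
apply: NNPP => none.
pose t := (c * INR n * x)%R.
have n1 : (1 <= INR n)%R by apply: (INR_leq (a := 1)).
have x_large : (2 * ln 4 + 425 * L <= x)%R.
  rewrite -[X in (X <= _)%R]ln_exp /x; have H := Rle_trans _ _ _ N0P (INR_leq nN0).
  case: H => [lt|->]; last exact: Rle_refl.
  by apply/Rlt_le/ln_increasing => //; apply: exp_pos.
have ln4 : (0 < ln 4)%R by rewrite -ln_1; apply: ln_increasing; lra.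
have t0 : (0 <= t)%R.
  apply: Rmult_le_pos; last lra; apply: Rmult_le_pos; lra.
(* Counting needs an integer bound; rounding [t] up costs at most 1. *)
have [K [tK Kt]] : exists K, (t < INR K)%R /\ (INR K <= t + 1)%R.
  have [up1 up2] := archimed t.
  have up0 : (0 <= up t)%Z by apply: le_IZR; lra.
  by have [K KE] := IZN _ up0; exists K; rewrite INR_IZR_INZ -KE; lra.
(* If no relabelling were far from the nest, all of them would be reachable in at most [K] flips. *)
have le_fact : m.+1`! <= expn q (4 * n + 49 * K).
  apply: nest_reachable_count => p pS; apply: NNPP => far; apply: none.
  exists (relabel p (nest m)); split.
  - exact: nest_ppt4.
  - exact/relabel_ppt4/nest_ppt4.
  - exact: nest_same_outer.
  move=> k pk; rewrite -/n -/x -/t; apply: Rnot_lt_le => kt; apply: far.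
  exists k => //; apply/leP/INR_le; lra.
have := ln_INR_leq (fact_gt0 m.+1) le_fact; rewrite ln_expn ?(ltnW q2) // -/L.
have := @ln_fact_lower m m4; rewrite -/n -/x.
have -> : INR (4 * n + 49 * K) = (4 * INR n + 49 * INR K)%R.
  by rewrite plus_INR !mult_INR /=; lra.
move=> lower upper.
have tL : (t * L = INR n * x / 392)%R.
  by transitivity (c * L * (INR n * x))%R; [rewrite /t; ring | rewrite cL; lra].
have KL : (INR K * L <= INR n * x / 392 + L)%R.
  by rewrite -tL; have := Rmult_le_compat_r _ _ _ (Rlt_le _ _ L0) Kt; lra.
(* Absorbs the rounding error [49 * L] into a multiple of [INR n * L]. *)
have nL : (L <= INR n * L)%R by nra.
have nx : (INR n * (2 * ln 4 + 425 * L) <= INR n * x)%R.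
  by apply: Rmult_le_compat_l; lra.
nra.
Qed.
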